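(* Let $G$ be a finitely presented group which has a surjective homomorphism $\chi:G\to\mathbb{Z}$ such that the Alexander polynomial $\Delta_{G,\chi}$ is equal to $0$. Then $G$ is large.
   Context: A finitely generated group is large if it has a finite index subgroup possessing a homomorphism onto a non-abelian free group. Alexander polynomial: let $G$ be a finitely presented group and $\chi:G\to\mathbb{Z}$ a surjective homomorphism. Choose $t\in G$ with $\chi(t)=1$; $t$ acts by conjugation on $H_1(\ker\chi;\mathbb{Z})$, making it a finitely presented module over the Laurent polynomial ring $\mathbb{Z}[t^{\pm1}]$. Take a finite presentation matrix $P$ of this module, with rows corresponding to module generators and columns to module relations. The first elementary ideal is the ideal of $\mathbb{Z}[t^{\pm1}]$ generated by the maximal minors of $P$, i.e. the determinants of the square matrices obtained by deleting columns until the number of columns equals the number of rows (if there are fewer columns than rows, the ideal is taken to be zero). This ideal does not depend on the choice of presentation matrix. The Alexander polynomial $\Delta_{G,\chi}(t)\in\mathbb{Z}[t^{\pm1}]$ is the generator (well defined up to units $\pm t^k$) of the smallest principal ideal containing the first elementary ideal; equivalently, the highest common factor of the maximal minors (zero if the ideal is zero). *)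

(* Defs.v *)
From HB Require Import structures.
From mathcomp Require Import all_boot all_order all_algebra.
From mathcomp Require Import fraction generic_quotient.
From mathcomp Require Import boolp classical_sets.

Set Implicit Arguments.
Unset Strict Implicit.
Unset Printing Implicit Defensive.

Import GRing.Theory.

Local Open Scope classical_set_scope.
Local Open Scope quotient_scope.
Local Open Scope group_scope.

Notation "{ 'ghom' G -> H }" := (UMagmaMorphism.type G%type H%type)
  (at level 0, G at level 98, H at level 99,
   format "{ 'ghom'  G  ->  H }") : type_scope.

Section Subgroups.
Variable G : groupType.

Record subgroup_of (S : groupClosed G) := SubgroupElt {
  subgroup_elt :> G;
  subgroup_eltP : subgroup_elt \in S }.

HB.instance Definition _ (S : groupClosed G) :=
  [isSub for @subgroup_elt S].
HB.instance Definition _ (S : groupClosed G) :=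
  [Choice of subgroup_of S by <:].

Lemma groupClosed_divg (S : groupClosed G) : group_closed S.
Proof. by split; [exact: gpred1|exact: gpredF]. Qed.

HB.instance Definition _ (S : groupClosed G) :=
  SubChoice_isSubGroup.Build G (fun x => x \in S) (subgroup_of S)
    (groupClosed_divg S).

Definition finite_index (S : groupClosed G) : Prop :=
  exists s : seq G, forall g : G, exists2 x, x \in s & x^-1 * g \in S.

Inductive gen (A : set G) : set G :=
| gen_one : gen A 1
| gen_mem x : A x -> gen A x
| gen_mul x y : gen A x -> gen A y -> gen A (x * y)
| gen_inv x : gen A x -> gen A x^-1.

Definition normal_closure (A : set G) : set G :=
  gen [set z | exists2 x, A x & exists g, z = x ^ g].

Definition derived : set G := gen [set z | exists x y, z = [~ x, y]].

End Subgroups.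

Arguments derived : clear implicits.

Section Kernel.
Variables (G H : groupType) (f : {ghom G -> H}).

Definition ker_pred : {pred G} := [pred x | f x == 1].

Lemma ker_one : 1 \in ker_pred.
Proof. by rewrite inE gmulf1. Qed.

Lemma ker_mul : mulg_closed ker_pred.
Proof. by move=> x y; rewrite !inE gmulfM => /eqP-> /eqP->; rewrite mulg1. Qed.

Lemma ker_inv : invg_closed ker_pred.
Proof. by move=> x; rewrite !inE gmulfV => /eqP->; rewrite invg1. Qed.

HB.instance Definition _ := isMulClosed.Build G ker_pred ker_mul.
HB.instance Definition _ := isMul1Closed.Build G ker_pred ker_one.
HB.instance Definition _ := isInvClosed.Build G ker_pred ker_inv.

Definition ker : groupClosed G := GroupClosed.clone G ker_pred _.

Lemma kerE x : (x \in ker) = (f x == 1).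
Proof. by []. Qed.

End Kernel.

Section FreeGroup.
Variable X : choiceType.

(* (x, true) stands for the generator x and (x, false) for its inverse *)
Notation letter := (X * bool)%type.

Definition linv (a : letter) : letter := (a.1, ~~ a.2).

Definition reduced (w : seq letter) : bool :=
  sorted (fun a b => b != linv a) w.

Definition push (a : letter) (w : seq letter) : seq letter :=
  if w is b :: w' then if b == linv a then w' else a :: w else [:: a].

Record free_group := FreeWord {
  free_word :> seq letter;
  free_word_reduced : reduced free_word }.

HB.instance Definition _ := [isSub for free_word].
HB.instance Definition _ := [Choice of free_group by <:].

Lemma linvK : involutive linv.
Proof. by case=> x b; rewrite /linv /= negbK. Qed.

Lemma reduced_push a w : reduced w -> reduced (push a w).
Proof.
case: w => //= b w; case: (eqVneq b (linv a)) => [_|nba] /=; last first.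
  by rewrite nba.
exact: path_sorted.
Qed.

Lemma push_linv a w : reduced w -> push a (push (linv a) w) = w.
Proof.
case: w => [|b w] /=; first by rewrite eqxx.
rewrite linvK; case: (eqVneq b a) => [->|nba] /=; last by rewrite eqxx.
by case: w => [|c w] //= /andP[/negPf->].
Qed.

Lemma reduced_foldr_push u v : reduced v -> reduced (foldr push v u).
Proof. by move=> rv; elim: u => //= a u; exact: reduced_push. Qed.

Lemma foldr_push_nil u : reduced u -> foldr push [::] u = u.
Proof.
elim: u => //= a u IHu ru; rewrite IHu; last exact: path_sorted ru.
by case: u ru {IHu} => //= b u /andP[/negPf->] _.
Qed.

Lemma foldr_push_push a u v : reduced v ->
  foldr push v (push a u) = push a (foldr push v u).
Proof.
move=> rv; case: u => //= b u; case: (eqVneq b (linv a)) => [->|//].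
by rewrite push_linv// reduced_foldr_push.
Qed.

Lemma foldr_push_assoc u v w : reduced w ->
  foldr push (foldr push w v) u = foldr push w (foldr push v u).
Proof. by move=> rw; elim: u => //= a u ->; rewrite foldr_push_push. Qed.

Definition free_one : free_group := @FreeWord [::] isT.

Definition free_mul (u v : free_group) : free_group :=
  FreeWord (reduced_foldr_push u (free_word_reduced v)).

Lemma reduced_rev_linv w : reduced w -> reduced (rev (map linv w)).
Proof.
rewrite /reduced rev_sorted sorted_map; apply: sub_sorted => a b /=.
by apply: contra_neq => ->; rewrite !linvK.
Qed.

Definition free_inv (u : free_group) : free_group :=
  FreeWord (reduced_rev_linv (free_word_reduced u)).

Lemma free_mulA : associative free_mul.
Proof.
by move=> u v w; apply: val_inj; rewrite /= foldr_push_assoc// free_word_reduced.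
Qed.

Lemma free_mul1 : left_id free_one free_mul.
Proof. by move=> u; apply: val_inj. Qed.

Lemma free_mulr1 : right_id free_one free_mul.
Proof. by move=> u; apply: val_inj; rewrite /= foldr_push_nil// free_word_reduced. Qed.

Lemma foldr_push_rev w v : reduced v ->
  foldr push (foldr push v w) (rev (map linv w)) = v.
Proof.
move=> rv; elim: w => //= a w IHw; rewrite rev_cons -cats1 foldr_cat /=.
by rewrite -[X in push _ (push X _)]linvK push_linv ?reduced_foldr_push.
Qed.

Lemma free_mulV : left_inverse free_one free_inv free_mul.
Proof.
move=> u; apply: val_inj => /=.
rewrite -[X in foldr _ X _](foldr_push_nil (free_word_reduced u)).
exact: foldr_push_rev.
Qed.

Lemma free_invK : involutive free_inv.
Proof.
move=> u; apply: val_inj => /=; rewrite map_rev revK -map_comp.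
by rewrite map_id_in// => a _ /=; rewrite linvK.
Qed.

Lemma free_mulVr : right_inverse free_one free_inv free_mul.
Proof. by move=> u; rewrite -{1}[u]free_invK free_mulV. Qed.

HB.instance Definition _ :=
  isGroup.Build free_group free_mulA free_mul1 free_mulr1 free_mulV free_mulVr.

Definition free_gen (x : X) : free_group := @FreeWord [:: (x, true)] isT.

End FreeGroup.

Definition finitely_presented (G : groupType) : Prop :=
  exists (n : nat) (rels : seq (free_group 'I_n))
    (p : {ghom free_group 'I_n -> G}),
    (forall g, exists w, p w = g) /\
    (forall w, p w = 1 <-> normal_closure [set r | r \in rels] w).

Definition large (G : groupType) : Prop :=
  exists (H : groupClosed G) (X : choiceType)
    (f : {ghom subgroup_of H -> free_group X}),
    [/\ finite_index H,
        exists u v : free_group X, u * v <> v * u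
      & forall w, exists h, f h = w].

Section Abelianization.
Variable K : groupType.

Lemma derivedJ x y : derived K x -> derived K (x ^ y).
Proof.
move=> Dx; rewrite -(mulVKg x (x ^ y)) -commgEl.
by apply: gen_mul => //; apply: gen_mem; exists x, y.
Qed.

Definition derived_eq : rel K := fun x y => `[< derived K (x / y) >].

Lemma derived_eq_refl : reflexive derived_eq.
Proof. by move=> x; apply/asboolP; rewrite divgg; exact: gen_one. Qed.

Lemma derived_eq_sym : symmetric derived_eq.
Proof.
by move=> x y; apply/asboolP/asboolP => /gen_inv; rewrite invgF.
Qed.

Lemma derived_eq_trans : transitive derived_eq.
Proof.
move=> y x z /asboolP xy /asboolP yz; apply/asboolP.
by rewrite -(divgK y x) -mulgA; exact: gen_mul.
Qed.

Canonical derived_equiv :=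
  EquivRel derived_eq derived_eq_refl derived_eq_sym derived_eq_trans.

Definition abelianization : Type := {eq_quot derived_equiv}.
HB.instance Definition _ := Choice.on abelianization.
HB.instance Definition _ := EqQuotient.on abelianization.

Definition abel_class (x : K) : abelianization := \pi x.

Lemma abel_classP x y : abel_class x = abel_class y <-> derived K (x / y).
Proof.
split=> [/eqmodP /asboolP//|xy]; apply/eqmodP; exact/asboolP.
Qed.

Lemma abel_class_repr a : abel_class (repr a) = a.
Proof. exact: reprK. Qed.

Definition abel_add (a b : abelianization) : abelianization :=
  abel_class (repr a * repr b).
Definition abel_opp (a : abelianization) : abelianization :=
  abel_class (repr a)^-1.

Lemma abel_addE x y : abel_add (abel_class x) (abel_class y) = abel_class (x * y).
Proof.
apply/abel_classP; set x' := repr _; set y' := repr _.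
have Dx : derived K (x' / x) by apply/abel_classP; rewrite abel_class_repr.
have Dy : derived K (y' / y) by apply/abel_classP; rewrite abel_class_repr.
have -> : x' * y' / (x * y) = (x' / x) * (y' / y) ^ x^-1.
  by rewrite conjgE invgK invgM !mulgA mulgVK.
by apply: gen_mul => //; exact: derivedJ.
Qed.

Lemma abel_oppE x : abel_opp (abel_class x) = abel_class x^-1.
Proof.
apply/abel_classP; set x' := repr _.
have Dx : derived K (x' / x) by apply/abel_classP; rewrite abel_class_repr.
have -> : x'^-1 / x^-1 = ((x' / x)^-1) ^ x' .
  by rewrite conjgE invgF invgK mulgVK.
exact/derivedJ/gen_inv.
Qed.

Lemma abel_addA : associative abel_add.
Proof.
move=> a b c; rewrite -[a]abel_class_repr -[b]abel_class_repr.
by rewrite -[c]abel_class_repr !abel_addE mulgA.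
Qed.

Lemma abel_addC : commutative abel_add.
Proof.
move=> a b; rewrite -[a]abel_class_repr -[b]abel_class_repr !abel_addE.
set x := repr a; set y := repr b; apply/abel_classP.
apply: gen_mem; exists x^-1, y^-1.
by rewrite commgEl conjgE !invgK invgM !mulgA.
Qed.

Lemma abel_add0 : left_id (abel_class 1) abel_add.
Proof. by move=> a; rewrite -[a]abel_class_repr abel_addE mul1g. Qed.

Lemma abel_addN : left_inverse (abel_class 1) abel_opp abel_add.
Proof.
by move=> a; rewrite -[a]abel_class_repr abel_oppE abel_addE mulVg.
Qed.

HB.instance Definition _ :=
  GRing.isZmodule.Build abelianization abel_addA abel_addC abel_add0 abel_addN.

Lemma abel_classM x y :
  abel_class (x * y) = (abel_class x + abel_class y)%R.
Proof. by rewrite -abel_addE. Qed.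

Lemma abel_classV x : abel_class x^-1 = (- abel_class x)%R.
Proof. by rewrite -abel_oppE. Qed.

End Abelianization.

Section AbelianizationMap.
Variables (K L : groupType) (f : {ghom K -> L}).

Definition abel_map (a : abelianization K) : abelianization L :=
  abel_class (f (repr a)).

Lemma derived_hom x : derived K x -> derived L (f x).
Proof.
elim=> {x} [|x [y [z ->]]|x y _ Dx _ Dy|x _ Dx].
- by rewrite gmulf1; exact: gen_one.
- by rewrite gmulfR; apply: gen_mem; exists (f y), (f z).
- by rewrite gmulfM; exact: gen_mul.
- by rewrite gmulfV; exact: gen_inv.
Qed.

Lemma abel_mapE x : abel_map (abel_class x) = abel_class (f x).
Proof.
apply/abel_classP; rewrite -gmulfF; apply: derived_hom.
by apply/abel_classP; rewrite abel_class_repr.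
Qed.


Lemma abel_map_additive : zmod_morphism abel_map.
Proof.
move=> a b; rewrite -[a]abel_class_repr -[b]abel_class_repr.
rewrite -abel_classV -abel_classM !abel_mapE gmulfF abel_classM.
by rewrite abel_classV.
Qed.

HB.instance Definition _ :=
  GRing.isZmodMorphism.Build (abelianization K) (abelianization L) abel_map
    abel_map_additive.

End AbelianizationMap.

(* Z[t, t^-1] is the subring of the fractions of {poly int} having a power of
   'X as denominator. *)

Section Laurent.
Local Open Scope ring_scope.
Local Notation "p %:F" := (FracField.tofrac p).

Definition laurent_pred : pred {fraction {poly int}} :=
  fun x => `[< exists p n, x = p%:F / 'X^n%:F >].

Lemma tofracXn_neq0 n : ('X^n : {poly int})%:F != 0.
Proof. by rewrite tofrac_eq0 monic_neq0 ?monicXn. Qed.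

Lemma laurent_addE (p q : {poly int}) n m :
  p%:F / 'X^n%:F + q%:F / 'X^m%:F
  = (p * 'X^m + q * 'X^n)%:F / 'X^(n + m)%:F.
Proof. by rewrite addf_div ?tofracXn_neq0// exprD !(tofracD, tofracM). Qed.

Lemma laurent_mulE (p q : {poly int}) n m :
  (p%:F / 'X^n%:F) * (q%:F / 'X^m%:F) = (p * q)%:F / 'X^(n + m)%:F.
Proof. by rewrite mulf_div exprD !tofracM. Qed.

Lemma laurent_oneE : 1 = 1%:F / ('X^0 : {poly int})%:F.
Proof. by rewrite expr0 tofrac1 divr1. Qed.

Lemma laurent_subring_closed : subring_closed laurent_pred.
Proof.
split.
- by apply/asboolP; exists 1, 0%N; exact: laurent_oneE.
- move=> x y /asboolP[p [n ->]] /asboolP[q [m ->]]; apply/asboolP.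
  exists (p * 'X^m + - q * 'X^n), (n + m)%N.
  by rewrite -laurent_addE tofracN mulNr.
- move=> x y /asboolP[p [n ->]] /asboolP[q [m ->]]; apply/asboolP.
  by exists (p * q), (n + m)%N; rewrite laurent_mulE.
Qed.

HB.instance Definition _ :=
  GRing.isSubringClosed.Build {fraction {poly int}} laurent_pred
    laurent_subring_closed.

Record laurent := Laurent {
  laurent_frac :> {fraction {poly int}};
  laurent_fracP : laurent_frac \in laurent_pred }.

HB.instance Definition _ := [isSub for laurent_frac].
HB.instance Definition _ := [Choice of laurent by <:].
HB.instance Definition _ := [SubChoice_isSubComNzRing of laurent by <:].

Lemma laurent_repr (x : laurent) :
  exists pn : {poly int} * nat, val x == pn.1%:F / 'X^(pn.2)%:F.
Proof. by have /asboolP[p [n xE]] := valP x; exists (p, n); apply/eqP. Qed.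

Lemma laurentX_subproof : ('X : {poly int})%:F \in laurent_pred.
Proof. by apply/asboolP; exists 'X, 0%N; rewrite expr0 tofrac1 divr1. Qed.

Definition laurentX : laurent := Laurent laurentX_subproof.

Section Action.
Variables (A : zmodType) (s s' : {additive A -> A}).
Implicit Types (p q : {poly int}) (a b : A) (x y : laurent).

Definition poly_act (p : {poly int}) (a : A) : A :=
  \sum_(i < size p) iter i s a *~ p`_i.

(* [s'] is meant to be the inverse of [s]; then ['X^n] acts as the n-th iterate
   of [s] and ['X^-n] as that of [s'], see [laurent_actE] *)
Definition laurent_act (x : laurent) (a : A) : A :=
  let pn := xchoose (laurent_repr x) in iter pn.2 s' (poly_act pn.1 a).

Lemma poly_act_widen n p a : (size p <= n)%N ->
  poly_act p a = \sum_(i < n) iter i s a *~ p`_i.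
Proof.
move=> pn; rewrite /poly_act (big_ord_widen n (fun i => iter i s a *~ p`_i))//.
rewrite big_mkcond; apply: eq_bigr => i _; case: ltnP => // pi.
by rewrite nth_default// mulr0z.
Qed.

Lemma iter_additive (g : {additive A -> A}) i : zmod_morphism (iter i g).
Proof. by elim: i => // i IHi a b; rewrite !iterS [iter i g _]IHi raddfB. Qed.

HB.instance Definition _ (g : {additive A -> A}) i :=
  GRing.isZmodMorphism.Build A A (iter i g) (@iter_additive g i).

Lemma poly_act_additive p : zmod_morphism (poly_act p).
Proof.
move=> a b; rewrite /poly_act -sumrB; apply: eq_bigr => i _.
by rewrite raddfB mulrzBl.
Qed.

HB.instance Definition _ p :=
  GRing.isZmodMorphism.Build A A (poly_act p) (poly_act_additive p).

Lemma poly_actDl p q a : poly_act (p + q) a = poly_act p a + poly_act q a.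
Proof.
pose n := maxn (size p) (size q).
rewrite (@poly_act_widen n) ?size_polyD//.
rewrite (@poly_act_widen n p) ?leq_maxl// (@poly_act_widen n q) ?leq_maxr//.
by rewrite -big_split; apply: eq_bigr => i _; rewrite coefD mulrzDr.
Qed.

Lemma poly_actMX p a : poly_act (p * 'X) a = poly_act p (s a).
Proof.
have sz : (size (p * 'X)%R <= (size p).+1)%N.
  by have [->|p0] := eqVneq p 0; rewrite ?mul0r ?size_poly0 ?size_mulX.
rewrite (poly_act_widen a sz) big_ord_recl coefMX mulr0z add0r.
by apply: eq_bigr => i _; rewrite coefMX /= -iterSr.
Qed.

Lemma poly_actMXn p n a : poly_act (p * 'X^n) a = poly_act p (iter n s a).
Proof.
elim: n a => [|n IHn] a; first by rewrite mulr1.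
by rewrite exprSr mulrA poly_actMX IHn -iterSr.
Qed.

Lemma poly_actMC p c a : poly_act (p * c%:P) a = poly_act p (a *~ c).
Proof.
have sz : (size (p * c%:P)%R <= size p)%N.
  by rewrite mulrC mul_polyC size_scale_leq.
rewrite (poly_act_widen a sz); apply: eq_bigr => i _.
by rewrite coefMC raddfMz -mulrzA mulrC.
Qed.

Lemma poly_actC c a : poly_act c%:P a = a *~ c.
Proof.
rewrite (@poly_act_widen 1) ?size_polyC_leq1// big_ord1 coefC.
by [].
Qed.

Lemma poly_act_comm (g : {additive A -> A}) p a :
  (forall b, s (g b) = g (s b)) -> poly_act p (g a) = g (poly_act p a).
Proof.
move=> sg; rewrite /poly_act raddf_sum; apply: eq_bigr => i _.
by rewrite raddfMz; congr (_ *~ _); elim: (i : nat) => //= k ->.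
Qed.

Lemma poly_actM p q a : poly_act (p * q) a = poly_act p (poly_act q a).
Proof.
elim/poly_ind: q a => [|q c IHq] a.
  by rewrite mulr0 -[0]/(0%:P) !poly_actC !mulr0z raddf0.
rewrite mulrDr mulrA !poly_actDl !poly_actMX IHq poly_actMC poly_actC.
by rewrite raddfD.
Qed.

Hypotheses (sK : cancel s s') (s'K : cancel s' s).

Lemma iter_can (f g : A -> A) n : cancel f g -> cancel (iter n f) (iter n g).
Proof. by move=> fK; elim: n => // n IHn a; rewrite iterSr [iter _ f _]iterS fK IHn. Qed.

Lemma poly_act_iter p n a : poly_act p (iter n s a) = iter n s (poly_act p a).
Proof.
by apply: poly_act_comm => b; rewrite /= -iterS -iterSr.
Qed.

Lemma poly_act_iterV p n a :
  poly_act p (iter n s' a) = iter n s' (poly_act p a).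
Proof.
apply: poly_act_comm => b /=; elim: n => //= n <-.
by rewrite s'K sK.
Qed.

Lemma laurent_actE (x : laurent) p n a :
  val x = p%:F / 'X^n%:F -> laurent_act x a = iter n s' (poly_act p a).
Proof.
rewrite /laurent_act; set pn := xchoose _; have := xchooseP (laurent_repr x).
rewrite -/pn; case: pn => q m /= /eqP-> /eqP.
rewrite eqr_div ?tofracXn_neq0// -!tofracM tofrac_eq => /eqP E.
have : poly_act (q * 'X^n) a = poly_act (p * 'X^m) a by rewrite E.
rewrite !poly_actMXn !poly_act_iter.
move=> /(congr1 (iter n s')); rewrite iter_can// => ->.
by rewrite -iterD addnC iterD iter_can.
Qed.

Lemma laurent_actA x y a :
  laurent_act x (laurent_act y a) = laurent_act (x * y) a.
Proof.
have [[p n] /= /eqP xE] := laurent_repr x.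
have [[q m] /= /eqP yE] := laurent_repr y.
rewrite (laurent_actE _ xE) (laurent_actE _ yE).
rewrite (@laurent_actE (x * y) (p * q) (n + m)); last first.
  by rewrite rmorphM /= xE yE laurent_mulE.
by rewrite poly_act_iterV poly_actM iterD.
Qed.

Lemma laurent_act1 : left_id 1 laurent_act.
Proof.
by move=> a; rewrite (@laurent_actE 1 1 0 a laurent_oneE) poly_actC.
Qed.

Lemma laurent_actX a : laurent_act laurentX a = s a.
Proof.
rewrite (@laurent_actE laurentX 'X 0); last by rewrite expr0 tofrac1 divr1.
by rewrite -['X]mul1r poly_actMX poly_actC.
Qed.

Lemma laurent_actDr : right_distributive laurent_act +%R.
Proof. by move=> x a b; rewrite /laurent_act !raddfD. Qed.

Lemma laurent_actDl a : {morph laurent_act^~ a : x y / x + y}.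
Proof.
move=> x y.
have [[p n] /= /eqP xE] := laurent_repr x.
have [[q m] /= /eqP yE] := laurent_repr y.
rewrite (laurent_actE _ xE) (laurent_actE _ yE).
rewrite (@laurent_actE (x + y) (p * 'X^m + q * 'X^n) (n + m)); last first.
  by rewrite rmorphD /= xE yE laurent_addE.
rewrite poly_actDl !poly_actMXn !poly_act_iter raddfD /=; congr (_ + _).
  by rewrite iterD iter_can.
by rewrite addnC iterD iter_can.
Qed.

End Action.
End Laurent.

Section AlexanderModule.
Variables (G : groupType) (chi : {ghom G -> Algebra.to_multiplicative int}).

Local Notation K := (subgroup_of (ker chi)).

Lemma ker_conj (t : G) (k : K) : val k ^ t^-1 \in ker chi.
Proof.
have := valP k; rewrite !kerE => /eqP k1.
by rewrite gmulfJ k1 conj1g.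
Qed.

(* [val k ^ t^-1] is [t * val k * t^-1] *)
Definition conj_ker (t : G) (k : K) : K := SubgroupElt (ker_conj t k).

Lemma conj_ker_divg t : {morph conj_ker t : x y / x / y}.
Proof. by move=> x y; apply: val_inj; rewrite /= conjMg conjVg. Qed.

HB.instance Definition _ t :=
  isGroupMorphism.Build K K (conj_ker t) (conj_ker_divg t).

Lemma abel_conjK t :
  cancel (abel_map (conj_ker t)) (abel_map (conj_ker t^-1)).
Proof.
move=> a; rewrite -[a]abel_class_repr !abel_mapE; congr abel_class.
by apply: val_inj; rewrite /= conjgK.
Qed.

Lemma abel_conjVK t :
  cancel (abel_map (conj_ker t^-1)) (abel_map (conj_ker t)).
Proof. by have := abel_conjK t^-1; rewrite invgK. Qed.

(* H_1(ker chi; Z), on which the Laurent variable acts as conjugation by [t] *)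
Definition alexander_module (t : G) : Type := abelianization K.

HB.instance Definition _ t := GRing.Zmodule.on (alexander_module t).
HB.instance Definition _ t :=
  GRing.Zmodule_isLmodule.Build laurent (alexander_module t)
    (laurent_actA (abel_conjK t) (abel_conjVK t))
    (laurent_act1 (abel_conjK t))
    (laurent_actDr (abel_map (conj_ker t)) (abel_map (conj_ker t^-1)))
    (laurent_actDl (abel_conjK t)).

Lemma alexander_module_scaleX (t : G) (k : K) :
  (laurentX *: (abel_class k : alexander_module t))%R
  = abel_class (conj_ker t k).
Proof. by rewrite -abel_mapE; exact: laurent_actX (abel_conjK t) _. Qed.

End AlexanderModule.

Section ElementaryIdeal.
Local Open Scope ring_scope.
Variable R : comNzRingType.

Definition presents (M : lmodType R) m n (P : 'M[R]_(m, n)) : Prop :=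
  exists g : 'I_m -> M,
    (forall v, exists c : 'cV_m, v = \sum_i c i 0 *: g i) /\
    (forall c : 'cV_m, \sum_i c i 0 *: g i = 0 <-> exists d, c = P *m d).

(* Deleting columns amounts to reindexing along a strictly increasing map. *)
Definition maximal_minor m n (P : 'M[R]_(m, n)) : set R :=
  [set x | exists f : 'I_m -> 'I_n,
     {homo f : i j / (i < j)%N} /\ x = \det (colsub f P)].

Inductive ideal_gen (A : set R) : set R :=
| ideal_gen0 : ideal_gen A 0
| ideal_gen_mem x : A x -> ideal_gen A x
| ideal_genD x y : ideal_gen A x -> ideal_gen A y -> ideal_gen A (x + y)
| ideal_genM c x : ideal_gen A x -> ideal_gen A (c * x).

Definition first_elementary_ideal m n (P : 'M[R]_(m, n)) : set R :=
  ideal_gen (maximal_minor P).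

Definition principal_ideal (d : R) : set R := ideal_gen [set d].

Definition smallest_principal_gen (I : set R) (d : R) : Prop :=
  I `<=` principal_ideal d /\
  forall e, I `<=` principal_ideal e -> principal_ideal d `<=` principal_ideal e.

End ElementaryIdeal.

(* The Alexander polynomial is only defined up to units, hence a relation. *)
Definition is_alexander_polynomial (G : groupType)
    (chi : {ghom G -> Algebra.to_multiplicative int}) (D : laurent) : Prop :=
  exists t : G, chi t = (1%R : int) /\
  exists m n (P : 'M[laurent]_(m, n)),
    presents (alexander_module chi t) P /\
    smallest_principal_gen (first_elementary_ideal P) D.

(* Main.v *)
From HB Require Import structures.
From mathcomp Require Import all_boot all_order all_algebra.
From mathcomp Require Import fraction generic_quotient.
From mathcomp Require Import boolp classical_sets.
From mathcomp Require Import zify ring.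
Require Import Defs.

(** Write R for Z[t, t^-1]. If the Alexander polynomial vanishes, all maximal minors
    of a presentation matrix of H_1(ker chi) vanish, so its rows are dependent over
    the field of fractions of R. Clearing denominators gives a nonzero R-linear map
    phi from H_1(ker chi) to R ([polynomial_relation], [functional_of_relation]).
    Reading off coefficients of phi turns it, together with chi, into a homomorphism
    from G to the wreath product of Z with Z. It is recorded as a function
    c : G -> Z -> Z with finitely supported values such that
      c (g h) r = c g r + c h (r + chi g),
    and after division by a common factor c k 0 = 1 for some k in ker chi
    ([large_of_functional]).

    The wreath product is solvable, so its subgroups of finite index have no free
    quotients of rank 2. But it is a limit of the groups in which the copies of Z are
    only required to commute when they are close to each other, and these do have such
    quotients after passing to a finite index subgroup. As G is finitely presented, the
    homomorphism lifts to such a group. This is made explicit as follows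
    ([large_of_shift_cocycle]).

    Let F be free on a and b, and n = 2L + 1. Functions f : Z -> F with
    f (r + q n) = a^q f(r) a^(-q) form a group on which Z acts by translation; in the
    semidirect product, the pairs (f, q n) form a subgroup of index n, mapped
    homomorphically to F by (f, q n) |-> f(0) a^q. Send g to the pair formed by chi g
    and the function equal to b^(c g r) for |r| <= L, extended to Z by the rule above
    ([folded]). This is not a homomorphism, but it respects the product of two given
    elements as soon as L is large: the functions are nontrivial only near the centres
    of the blocks of length n, and the factor a only intervenes at the boundaries of the
    blocks ([foldedD], [fold_cocycleM]). Finitely many relators require finitely many
    such products, so for large L the values on the generators do extend to a
    homomorphism on G. The subgroup where n divides chi then maps onto F: t^n goes to a,
    and k goes to b. *)

Set Implicit Arguments.
Unset Strict Implicit.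
Unset Printing Implicit Defensive.

Import GRing.Theory.
Local Open Scope group_scope.

(** * Integer powers in a group *)

Section IntegerPowers.
Variable G : groupType.
Implicit Types (x y : G) (m n : int).

Definition expgz x n : G :=
  match n with Posz k => x ^+ k | Negz k => x ^- k.+1 end.

Lemma expgz1 x : expgz x 1%R = x.
Proof. by []. Qed.

Lemma expgzS x n : expgz x (n + 1)%R = expgz x n * x.
Proof.
case: n => k.
  have -> : (Posz k + 1 = Posz k.+1)%R by lia.
  exact: expgSr.
case: k => [|k]; first by rewrite /= mulVg.
have -> : (Negz k.+1 + 1 = Negz k)%R by lia.
by rewrite /= [x ^+ k.+2]expgS invgM mulgVK.
Qed.

Lemma expgzB1 x n : expgz x (n - 1)%R = expgz x n * x^-1.
Proof. by rewrite -{2}[n](GRing.subrK 1%R) expgzS mulgK. Qed.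

Lemma expgzD x m n : expgz x (m + n)%R = expgz x m * expgz x n.
Proof.
case: n => k.
  elim: k => [|k IHk]; first by rewrite GRing.addr0 mulg1.
  have -> : (m + Posz k.+1 = m + Posz k + 1)%R by lia.
  have -> : (Posz k.+1 = Posz k + 1)%R by lia.
  by rewrite !expgzS IHk mulgA.
elim: k => [|k IHk]; first exact: expgzB1.
have -> : (m + Negz k.+1 = m + Negz k - 1)%R by lia.
have -> : (Negz k.+1 = Negz k - 1)%R by lia.
by rewrite !expgzB1 IHk mulgA.
Qed.

Lemma expgzN x n : expgz x (- n)%R = (expgz x n)^-1.
Proof. by apply/esym/mulg1_eq; rewrite -expgzD subrr. Qed.

End IntegerPowers.

(** * Crossed homomorphisms on a free group *)

Section FreeGroupCocycles.
Variables (X : choiceType) (F : groupType) (alpha : X -> int -> F)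
  (delta : X -> int).
Implicit Types (a : X * bool) (u v : free_group X) (r : int).

Definition free_letter a : free_group X :=
  if a.2 then free_gen a.1 else (free_gen a.1)^-1.

Lemma free_letterM a u : val (free_letter a * u) = push a (val u).
Proof. by case: a => x []. Qed.

(** Peeling off the first letter of a reduced word; this reduces statements on a
    free group to the behaviour of [push]. *)
Lemma free_group_letter_ind (P : free_group X -> Prop) :
  P 1 -> (forall a u, P u -> P (free_letter a * u)) -> forall u, P u.
Proof.
move=> P1 PM [w rw]; elim: w rw => [|a w IHw] rw.
  by have -> : FreeWord rw = 1 by exact: val_inj.
have rw' : reduced w by exact: path_sorted rw.
have -> : FreeWord rw = free_letter a * FreeWord rw'.
  apply: val_inj; rewrite free_letterM /=.
  by case: (w) rw => //= b w' /andP[/negPf->].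
exact: PM.
Qed.

Definition letter_degree a : int :=
  if a.2 then delta a.1 else (- delta a.1)%R.

(** A crossed homomorphism f, that is, f (u * v) r = f u r * f v (r + deg u),
    is determined by its values on the generators; the value on an inverse
    generator is forced by f 1 = 1. *)
Definition letter_cocycle a r : F :=
  if a.2 then alpha a.1 r else (alpha a.1 (r - delta a.1)%R)^-1.

Fixpoint word_degree (w : seq (X * bool)) : int :=
  if w is a :: w' then (letter_degree a + word_degree w')%R else 0%R.

Fixpoint word_cocycle (w : seq (X * bool)) r : F :=
  if w is a :: w' then letter_cocycle a r * word_cocycle w' (r + letter_degree a)%R
  else 1.

Definition free_degree u := word_degree (val u).
Definition free_cocycle u := word_cocycle (val u).

Lemma letter_degreeV a : letter_degree (linv a) = (- letter_degree a)%R.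
Proof. by case: a => x [] //=; rewrite /letter_degree /= opprK. Qed.

Lemma letter_cocycleV a r :
  letter_cocycle a r * letter_cocycle (linv a) (r + letter_degree a)%R = 1.
Proof.
case: a => x []; rewrite /letter_degree /letter_cocycle /=.
  by rewrite addrK mulgV.
by rewrite mulVg.
Qed.

Lemma free_degree_letterM a u :
  free_degree (free_letter a * u) = (letter_degree a + free_degree u)%R.
Proof.
rewrite /free_degree free_letterM; case: (val u) => //= b w.
by case: eqP => // ->; rewrite letter_degreeV; lia.
Qed.

Lemma free_cocycle_letterM a u r :
  free_cocycle (free_letter a * u) r =
  letter_cocycle a r * free_cocycle u (r + letter_degree a)%R.
Proof.
rewrite /free_cocycle free_letterM; case: (val u) => //= b w.
case: eqP => // ->; rewrite mulgA letter_cocycleV mul1g letter_degreeV.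
by rewrite addrK.
Qed.

Lemma free_degreeM u v : free_degree (u * v) = (free_degree u + free_degree v)%R.
Proof.
elim/free_group_letter_ind: u => [|a u IHu]; first by rewrite mul1g /free_degree add0r.
by rewrite -mulgA !free_degree_letterM IHu addrA.
Qed.

Lemma free_cocycleM u v r :
  free_cocycle (u * v) r = free_cocycle u r * free_cocycle v (r + free_degree u)%R.
Proof.
elim/free_group_letter_ind: u r => [|a u IHu] r.
  by rewrite !mul1g addr0.
by rewrite -mulgA !free_cocycle_letterM IHu free_degree_letterM mulgA addrA.
Qed.

Lemma free_degreeV u : free_degree u^-1 = (- free_degree u)%R.
Proof.
have := free_degreeM u^-1 u; rewrite mulVg {1}/free_degree /=; lia.
Qed.

(** Triviality passes to conjugates only in degree zero: in f (g^-1 * x * g) the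
    two outer factors are evaluated at points that differ by the degree of x. *)
Lemma free_cocycle_normal_closure (A : set (free_group X)) :
  (forall u, A u -> free_degree u = 0%R /\ forall r, free_cocycle u r = 1) ->
  forall u, normal_closure A u -> forall r, free_cocycle u r = 1.
Proof.
move=> A1 u Au.
suff [] : free_degree u = 0%R /\ forall r, free_cocycle u r = 1 by [].
elim: Au => {u} [|_ [x /A1[dx cx] [g ->]]|x y _ [dx cx] _ [dy cy]|x _ [dx cx]].
- by split.
- split; first by rewrite !free_degreeM free_degreeV dx; lia.
  move=> r; rewrite !free_cocycleM cx dx addr0 mul1g -free_cocycleM mulVg.
  by [].
- split; first by rewrite free_degreeM dx dy.
  by move=> r; rewrite free_cocycleM cx cy mul1g.
- split; first by rewrite free_degreeV dx.
  move=> r; have := free_cocycleM x x^-1 r.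
  by rewrite mulgV cx mul1g dx addr0 => <-.
Qed.

End FreeGroupCocycles.

(** * Folding a finitely supported function into blocks *)

Section Folding.
Variables (F : groupType) (a b : F) (L : nat).
Implicit Types (r q s : int) (c : int -> int).

(** The line is cut into blocks of length [period], each centred at a multiple
    of [period]; [lap r] is the number of the block of [r] and [residue r], between
    -L and L, is the position of [r] relative to the centre. *)
Definition period : int := L.*2.+1.
Definition lap r : int := ((r + L%:Z) %/ period)%Z.
Definition residue r : int := (((r + L%:Z) %% period)%Z - L%:Z)%R.

(** The block boundaries are at distance L from the centres, hence away from the
    support of [c] when L is large. This is what makes [folded] additive in the
    sense of [foldedD] although the conjugator jumps at the boundaries. *)
Definition folded c r : F := expgz b (c (residue r)) ^ expgz a (- lap r)%R.

Lemma lap_residue r :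
  (r = lap r * period + residue r)%R /\ (`|residue r| <= L)%N.
Proof.
have P0 : period != 0%R by [].
have E := divz_eq (r + L%:Z)%R period.
have := modz_ge0 (r + L%:Z)%R P0; have := ltz_pmod (r + L%:Z)%R (isT : (0 < period)%R).
rewrite /residue /lap /period in E *; lia.
Qed.

Lemma lapE q s : (`|s| <= L)%N -> lap (q * period + s)%R = q.
Proof.
move=> sL; rewrite /lap -(addrA _ s) divzMDl// divz_small ?addr0//.
rewrite /period; lia.
Qed.

Lemma residueE q s : (`|s| <= L)%N -> residue (q * period + s)%R = s.
Proof.
move=> sL; rewrite /residue -(addrA _ s) modzMDl modz_small ?addrK//.
rewrite /period; lia.
Qed.

Lemma folded_period c r q :
  folded c (r + q * period)%R = folded c r ^ expgz a (- q)%R.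
Proof.
have [E rL] := lap_residue r; rewrite /folded {1 2}E.
have -> : (lap r * period + residue r + q * period =
  (lap r + q) * period + residue r)%R by ring.
by rewrite lapE// residueE// -conjgM -expgzD opprD.
Qed.

Lemma folded0 c r : c (residue r) = 0%R -> folded c r = 1.
Proof. by rewrite /folded => ->; rewrite conj1g. Qed.

(** If the translation by [m] keeps [r] in its block, both sides are powers of
    [b] under the same conjugator. If it moves [r] to another block, then [r] and
    [r + m] are within |m| of a block boundary, where all functions involved
    vanish. *)
Lemma foldedD c d (m : int) (B : nat) r :
  (forall s, B < `|s| -> c s = 0%R)%N -> (forall s, B < `|s| -> d s = 0%R)%N ->
  (`|m| + B <= L)%N ->
  folded (fun s => c s + d (s + m))%R r = folded c r * folded d (r + m)%R.
Proof.
move=> c0 d0 BL; have [E rL] := lap_residue r.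
have [mL|Lm] := leqP `|(residue r + m)%R|%N L.
  have Em : (r + m = lap r * period + (residue r + m))%R by lia.
  rewrite /folded Em lapE// residueE// -conjMg.
  by rewrite expgzD.
rewrite !folded0 ?mulg1//; last first.
- by rewrite c0 ?d0//; lia.
- by rewrite c0//; lia.
(* [e] is the direction in which the boundary is crossed *)
- pose e : int := (if (0 < residue r + m)%R then 1 else -1)%R.
  have Em : (r + m = (lap r + e) * period + (residue r + m - e * period))%R by lia.
  have eL : (`|(residue r + m - e * period)%R| <= L)%N.
    rewrite /e /period; case: ifP; lia.
  rewrite Em residueE//; apply: d0; move: eL; rewrite /e /period; case: ifP; lia.
Qed.

End Folding.

(** * From a shift cocycle to a finite index subgroup with free image *)

Lemma free_group_bool_nonabelian :
  (free_gen true : free_group bool) * free_gen false <> free_gen false * free_gen true.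
Proof. by move/(congr1 val). Qed.

Lemma free_group_image_full (X : choiceType) (H : groupType)
    (f : {ghom H -> free_group X}) :
  (forall x, exists h, f h = free_gen x) -> forall u, exists h, f h = u.
Proof.
move=> fgen; elim/free_group_letter_ind => [|[x e] u [h fh]].
  by exists 1; rewrite gmulf1.
have [k fk] := fgen x; exists ((if e then k else k^-1) * h).
by rewrite gmulfM fh; case: e; rewrite ?gmulfV fk.
Qed.

(** A pair [deg], [c] as below is the same as a homomorphism from [G] to the wreath
    product of Z with Z: the base group consists of the finitely supported functions
    on Z, and [deg] is the component in the group of shifts. *)
Section ShiftCocycle.
Variables (G : groupType) (deg : G -> int) (c : G -> int -> int).
Hypotheses (degM : forall g h, deg (g * h) = (deg g + deg h)%R)
  (cM : forall g h r, c (g * h) r = (c g r + c h (r + deg g))%R)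
  (c_fin : forall g, exists B : nat, forall r, (B < `|r|)%N -> c g r = 0%R).

Lemma deg1 : deg 1 = 0%R.
Proof. have := degM 1 1; rewrite mulg1; lia. Qed.

Lemma degV g : deg g^-1 = (- deg g)%R.
Proof. have := degM g g^-1; rewrite mulgV deg1; lia. Qed.

Lemma shift_cocycle1 r : c 1 r = 0%R.
Proof. have := cM 1 1 r; rewrite mulg1 deg1 addr0; lia. Qed.

Section Fold.
Variables (F : groupType) (a b : F).

Definition fold_cocycle L g := folded a b L (c g).

Lemma fold_cocycle1 L r : fold_cocycle L 1 r = 1.
Proof. by rewrite /fold_cocycle folded0// shift_cocycle1. Qed.

(** Folding is a crossed homomorphism only asymptotically: the bound on [L]
    depends on the supports of the two functions and on the degree of [g]. *)
Lemma fold_cocycleM g h : exists B, forall L, (B <= L)%N -> forall r,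
  fold_cocycle L (g * h) r = fold_cocycle L g r * fold_cocycle L h (r + deg g)%R.
Proof.
have [Bg cg] := c_fin g; have [Bh ch] := c_fin h.
exists (`|deg g| + maxn Bg Bh)%N => L BL r; rewrite /fold_cocycle.
rewrite -(@foldedD _ _ _ _ _ _ _ (maxn Bg Bh))//.
- by rewrite /folded cM.
- by move=> s; rewrite gtn_max => /andP[/cg].
- by move=> s; rewrite gtn_max => /andP[_ /ch].
Qed.

Variables (X : choiceType) (p : {ghom free_group X -> G}).

Definition gen_degree x := deg (p (free_gen x)).
Definition gen_cocycle L x := fold_cocycle L (p (free_gen x)).
(** For a fixed [L], the honest crossed homomorphism on the free group that agrees
    with [fold_cocycle] on the generators. *)
Definition lift_cocycle L u r := free_cocycle (gen_cocycle L) gen_degree u r.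

Lemma letter_degreeE l : letter_degree gen_degree l = deg (p (free_letter l)).
Proof.
by case: l => x []; rewrite /letter_degree /free_letter /= ?gmulfV ?degV.
Qed.

Lemma free_degreeE u : free_degree gen_degree u = deg (p u).
Proof.
elim/free_group_letter_ind: u => [|l u IHu]; first by rewrite gmulf1 deg1.
by rewrite free_degree_letterM IHu letter_degreeE gmulfM degM.
Qed.

Lemma lift_cocycleM L u v r :
  lift_cocycle L (u * v) r =
  lift_cocycle L u r * lift_cocycle L v (r + deg (p u))%R.
Proof. by rewrite -free_degreeE -free_cocycleM. Qed.

Lemma letter_cocycleE l : exists B, forall L, (B <= L)%N -> forall r,
  letter_cocycle (gen_cocycle L) gen_degree l r =
  fold_cocycle L (p (free_letter l)) r.
Proof.
case: l => x []; first by exists 0%N.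
rewrite /letter_cocycle /free_letter /= gmulfV /gen_degree /gen_cocycle.
set g := p _; have [B gB] := fold_cocycleM g g^-1.
exists B => L BL r; apply/mulg1_eq.
have := gB _ BL (r - deg g)%R; rewrite mulgV fold_cocycle1 subrK.
by move=> <-.
Qed.

(** Only finitely many products are formed when a word is spelled out, so
    [fold_cocycleM] applies to all of them once [L] is large. *)
Lemma lift_cocycleE u : exists B, forall L, (B <= L)%N -> forall r,
  lift_cocycle L u r = fold_cocycle L (p u) r.
Proof.
elim/free_group_letter_ind: u => [|l u [B IHu]].
  by exists 0%N => L _ r; rewrite gmulf1 fold_cocycle1.
have [Bl lE] := letter_cocycleE l.
have [Bm mE] := fold_cocycleM (p (free_letter l)) (p u).
exists (maxn (maxn B Bl) Bm) => L; rewrite !geq_max -andbA.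
move=> /and3P[BL BlL BmL] r; rewrite gmulfM mE// -lE// -IHu// -letter_degreeE.
exact: free_cocycle_letterM.
Qed.

Lemma lift_cocycleE_seq (us : seq (free_group X)) :
  exists L, forall u, u \in us -> forall r,
  lift_cocycle L u r = fold_cocycle L (p u) r.
Proof.
suff [B uB] : exists B, forall L, (B <= L)%N -> forall u, u \in us -> forall r,
    lift_cocycle L u r = fold_cocycle L (p u) r by exists B; exact: uB.
elim: us => [|u us [B IHus]]; first by exists 0%N.
have [Bu uE] := lift_cocycleE u; exists (maxn B Bu) => L.
rewrite geq_max => /andP[BL BuL] v; rewrite inE => /predU1P[->|vus].
  exact: uE.
exact: IHus.
Qed.

(** Translation by a period commutes with every step in the construction of the
    cocycle, so the twisted periodicity of [folded] is inherited. *)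
Lemma lift_cocycle_period L u r q :
  lift_cocycle L u (r + q * period L)%R =
  lift_cocycle L u r ^ expgz a (- q)%R.
Proof.
rewrite /lift_cocycle; elim/free_group_letter_ind: u r => [|l u IHu] r.
  by rewrite conj1g.
rewrite !free_cocycle_letterM conjMg -IHu; congr (_ * _).
  case: l => x []; rewrite /letter_cocycle /=; first exact: folded_period.
  rewrite conjVg /gen_cocycle /fold_cocycle -folded_period; congr (folded _ _ _ _ _)^-1.
  by rewrite addrAC.
by rewrite addrAC.
Qed.

End Fold.

Section PeriodSubgroup.
Variable L : nat.

Definition period_pred : {pred G} := [pred g | (period L %| deg g)%Z].

Lemma period_one : 1 \in period_pred.
Proof. by rewrite inE deg1 dvdz0. Qed.

Lemma period_mul : mulg_closed period_pred.
Proof. by move=> x y; rewrite !inE degM; exact: rpredD. Qed.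

Lemma period_inv : invg_closed period_pred.
Proof. by move=> x; rewrite !inE degV rpredN. Qed.

HB.instance Definition _ := isMulClosed.Build G period_pred period_mul.
HB.instance Definition _ := isMul1Closed.Build G period_pred period_one.
HB.instance Definition _ := isInvClosed.Build G period_pred period_inv.

Definition period_group : groupClosed G := GroupClosed.clone G period_pred _.

Lemma deg_expg t m : deg t = 1%R -> deg (t ^+ m) = m%:Z%R.
Proof.
move=> dt; elim: m => [|m IHm]; first exact: deg1.
by rewrite expgS degM IHm dt.
Qed.

Lemma period_group_finite_index t : deg t = 1%R -> finite_index period_group.
Proof.
move=> dt; exists [seq t ^+ i | i <- iota 0 L.*2.+1] => g.
pose m := `|(deg g %% period L)%Z|%N.
have mE : m%:Z%R = (deg g %% period L)%Z.
  by rewrite gez0_abs// modz_ge0.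
exists (t ^+ m).
  apply: map_f; rewrite mem_iota add0n -ltz_nat mE.
  by rewrite (ltz_pmod _ (isT : (0 < period L)%R)).
apply/dvdzP; exists (deg g %/ period L)%Z.
rewrite degM degV deg_expg// mE; have := divz_eq (deg g) (period L); lia.
Qed.

End PeriodSubgroup.

(** Let [L] be so large that the lifted cocycle equals the folded one on the
    relators and on words for [t] and [k]. It is then trivial on the relators and
    descends to a crossed homomorphism ev on [G]. On the elements whose degree is
    q times the period, g |-> ev g 0 * a^q is a homomorphism: by periodicity,
    evaluating the second factor of ev (g * h) 0 at the degree of g conjugates it by
    a^q. It sends t^period to a and [k] to b. *)
Lemma large_of_shift_cocycle (t k : G) : finitely_presented G ->
  deg t = 1%R -> (forall r, c t r = 0%R) -> deg k = 0%R -> c k 0%R = 1%R ->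
  large G.
Proof.
move=> [n [rels [p [p_surj p_ker]]]] dt ct dk ck.
pose a : free_group bool := free_gen true.
pose b : free_group bool := free_gen false.
have [[wt pt] [wk pk]] := (p_surj t, p_surj k).
have [L LE] := lift_cocycleE_seq a b p (wt :: wk :: rels).
pose ev := lift_cocycle a b p L.
have ev1 u : p u = 1 -> forall r, ev u r = 1.
  move/p_ker; apply: free_cocycle_normal_closure => v /= vr.
  have pv : p v = 1.
    by apply/p_ker/gen_mem; exists v => //; exists 1; rewrite conjg1.
  split=> [|r]; first by rewrite free_degreeE pv deg1.
  rewrite -[LHS]/(lift_cocycle a b p L v r) LE ?pv ?fold_cocycle1//.
  by rewrite !inE vr !orbT.
have evM u v r : ev (u * v) r = ev u r * ev v (r + deg (p u))%R.
  exact: lift_cocycleM.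
(* [ev] factors through [p] because its restriction to the kernel is trivial *)
have ev_eq u v : p u = p v -> forall r, ev u r = ev v r.
  move=> puv r; rewrite -[u](mulgVK v) evM.
  have puv1 : p (u * v^-1) = 1 by rewrite gmulfF puv divgg.
  by rewrite ev1// mul1g puv1 deg1 addr0.
pose w g := sval (cid (p_surj g)).
have pw g : p (w g) = g by exact: svalP (cid (p_surj g)).
pose H := period_group L.
pose f (h : subgroup_of H) : free_group bool :=
  ev (w (val h)) 0%R * expgz a (deg (val h) %/ period L)%Z.
have degH (h : subgroup_of H) :
    deg (val h) = ((deg (val h) %/ period L)%Z * period L)%R.
  by rewrite divzK//; exact: (valP h).
have fM : {morph f : x y / x * y}.
  move=> x y; rewrite /f /=.
  rewrite (ev_eq _ (w (val x) * w (val y))) ?gmulfM ?pw// evM pw degM.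
  rewrite divzDl; last exact: (valP x).
  have -> : ev (w (val y)) (0 + deg (val x))%R =
      ev (w (val y)) 0%R ^ expgz a (- (deg (val x) %/ period L)%Z)%R.
    by rewrite {1}degH; exact: lift_cocycle_period.
  by rewrite expgzN conjgE invgK expgzD -!mulgA mulKg.
have fB : {morph f : x y / x / y}.
  by move=> x y; apply: (mulIg (f y)); rewrite -fM !mulgVK.
pose fh : {ghom subgroup_of H -> free_group bool} :=
  HB.pack f (isGroupMorphism.Build _ _ f fB).
exists H, bool, fh; split.
- exact: period_group_finite_index dt.
- by exists a, b; exact: free_group_bool_nonabelian.
apply: free_group_image_full => -[].
- have tH : t ^+ L.*2.+1 \in H by rewrite inE deg_expg// dvdzz.
  have ev_t m r : ev (wt ^+ m) r = 1.
    elim: m r => // m IHm r; rewrite expgS evM IHm mulg1.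
    rewrite -[LHS]/(lift_cocycle a b p L wt r) LE ?mem_head// pt.
    by rewrite /fold_cocycle folded0// ct.
  exists (SubgroupElt tH); rewrite -[LHS]/(f _) /f /=.
  rewrite (ev_eq _ (wt ^+ L.*2.+1)) ?pw ?gmulfXn ?pt// ev_t mul1g.
  by rewrite deg_expg// divzz.
- have kH : k \in H by rewrite inE dk dvdz0.
  exists (SubgroupElt kH); rewrite -[LHS]/(f _) /f /= dk div0z mulg1.
  rewrite (ev_eq _ wk) ?pw//.
  rewrite -[LHS]/(lift_cocycle a b p L wk 0%R) LE ?inE ?eqxx ?orbT// pk.
  have z0 : (0 * period L + 0 = 0)%R by rewrite mul0r.
  rewrite /fold_cocycle /folded -z0 residueE// lapE// ck oppr0 conjg1.
  by [].
Qed.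

End ShiftCocycle.

(** * Matrices with vanishing maximal minors *)

Section MinorsAndRank.
Local Open Scope ring_scope.

Lemma increasing_enum n (A : {set 'I_n}) m : #|A| = m ->
  exists2 h : 'I_m -> 'I_n,
    {homo h : i j / (i < j)%N} & forall x, x \in A -> exists i, h i = x.
Proof.
move=> <-; exists (@enum_val _ (mem A)); last first.
  by move=> x Ax; exists (enum_rank_in Ax x); rewrite enum_rankK_in.
move=> i j ij; have x0 : 'I_n := enum_val i; rewrite !(enum_val_nth x0).
have A_sorted : sorted (relpre val ltn) (enum A).
  rewrite /enum_mem; apply: sorted_filter.
    by move=> x y z; apply: ltn_trans.
  rewrite -enumT -sorted_map val_enum_ord; exact: iota_ltn_sorted.
apply: (sorted_ltn_nth _ _ A_sorted) => //; rewrite ?inE -?cardE ?ltn_ord//.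
by move=> x y z; apply: ltn_trans.
Qed.

(** A matrix with independent rows has a set of columns forming an invertible
    square matrix. [fullrankfun] selects them by an injection; enumerating its
    image in increasing order gives a matrix with the same rows up to order. *)
Lemma row_dependent_of_minors0 (K : fieldType) m n (P : 'M[K]_(m, n)) :
  (forall f : 'I_m -> 'I_n, {homo f : i j / (i < j)%N} ->
     \det (colsub f P) = 0) ->
  exists2 v : 'rV_m, v != 0 & v *m P = 0.
Proof.
move=> P0; suff : kermx P != 0.
  move=> /rowV0Pn[v /sub_kermxP vP v0]; by exists v.
rewrite kermx_eq0; apply/negP => Pfree.
have Pfull : row_full P^T by rewrite /row_full mxrank_tr.
pose f := fullrankfun Pfull.
have cA : #|f @: 'I_m| = m.
  rewrite card_imset; first by rewrite card_ord.
  exact: fullrankfun_inj.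
have [h h_incr h_onto] := increasing_enum cA.
suff : rowsub h P^T \in unitmx.
  by rewrite -trmx_mxsub unitmx_tr unitmxE P0// unitr0.
rewrite -row_full_unit -sub1mx.
apply: submx_trans (_ : (rowsub f P^T <= _)%MS).
  by rewrite sub1mx row_full_unit fullrowsub_unit.
apply/row_subP => i; have [|j hj] := h_onto (f i); first exact: imset_f.
have -> : row i (rowsub f P^T) = row j (rowsub h P^T).
  by apply/rowP => l; rewrite !mxE hj.
exact: row_sub.
Qed.

Lemma common_denominator (R : idomainType) m (v : 'I_m -> {fraction R}) :
  exists2 d : R, d != 0 &
    exists u : 'I_m -> R, forall i, FracField.tofrac d * v i = FracField.tofrac (u i).
Proof.
have frac_repr (x : {fraction R}) : exists nd : R * R,
    nd.2 != 0 /\ FracField.tofrac nd.2 * x = FracField.tofrac nd.1.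
  elim/quotW: x => x; exists (frac x); split; first exact: denom_ratioP.
  rewrite !piE; apply/eqmodP => /=.
  rewrite /FracField.equivf /FracField.mulf.
  rewrite !numden_Ratio ?mulf_neq0 ?oner_eq0 ?denom_ratioP//.
  by rewrite mulr1 mul1r.
pose nd i := sval (cid (frac_repr (v i))).
have nd0 i : (nd i).2 != 0 by have [] := svalP (cid (frac_repr (v i))).
have ndE i : FracField.tofrac (nd i).2 * v i = FracField.tofrac (nd i).1.
  by have [] := svalP (cid (frac_repr (v i))).
exists (\prod_i (nd i).2); first by apply/prodf_neq0 => i _.
exists (fun i => (nd i).1 * \prod_(j | j != i) (nd j).2) => i.
by rewrite (bigD1 i)//= !tofracM -ndE mulrAC.
Qed.

End MinorsAndRank.

(** * Coefficients of Laurent polynomials *)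

Section LaurentCoefficients.
Local Open Scope ring_scope.
Implicit Types (p q : {poly int}) (x y : laurent) (j : int).
Local Notation "p %:F" := (FracField.tofrac p).

Definition int_coef p j : int := if j is Posz k then p`_k else 0.

Lemma int_coefMXn p n j : int_coef (p * 'X^n) (j + n) = int_coef p j.
Proof.
case: j => k /=; first by rewrite coefMXn addnK ltnNge leq_addl.
case E : (Negz k + n) => [l|//] /=.
by rewrite coefMXn; have -> : (l < n)%N by lia.
Qed.

Lemma int_coefD p q j : int_coef (p + q) j = int_coef p j + int_coef q j.
Proof. by case: j => k //=; rewrite coefD. Qed.

Definition laurent_coef x j : int :=
  let pn := xchoose (laurent_repr x) in int_coef pn.1 (j + pn.2).

Lemma laurent_coefE x p n j :
  val x = p%:F / 'X^n%:F -> laurent_coef x j = int_coef p (j + n).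
Proof.
rewrite /laurent_coef; set pn := xchoose _; have := xchooseP (laurent_repr x).
rewrite -/pn; case: pn => q m /= /eqP-> /eqP.
rewrite eqr_div ?tofracXn_neq0// -!tofracM tofrac_eq => /eqP E.
by rewrite -(int_coefMXn _ n) E addrAC int_coefMXn.
Qed.

Lemma laurent_coefD x y j :
  laurent_coef (x + y) j = laurent_coef x j + laurent_coef y j.
Proof.
have [[p n] /= /eqP xE] := laurent_repr x.
have [[q m] /= /eqP yE] := laurent_repr y.
rewrite (laurent_coefE _ xE) (laurent_coefE _ yE).
rewrite (@laurent_coefE (x + y) (p * 'X^m + q * 'X^n) (n + m)); last first.
  by rewrite rmorphD /= xE yE laurent_addE.
rewrite int_coefD PoszD addrA int_coefMXn.
by rewrite addrAC int_coefMXn.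
Qed.

Lemma laurent_coefXM x j : laurent_coef (laurentX * x) j = laurent_coef x (j - 1).
Proof.
have [[p n] /= /eqP xE] := laurent_repr x.
rewrite (laurent_coefE _ xE) (@laurent_coefE (laurentX * x) (p * 'X^1) n).
  by rewrite -(int_coefMXn p 1); congr (int_coef _ _); lia.
by rewrite rmorphM /= xE tofracM mulrCA mulrA.
Qed.

Lemma laurent_coef_fin x :
  exists B : nat, forall j, (B < `|j|)%N -> laurent_coef x j = 0.
Proof.
have [[p n] /= /eqP xE] := laurent_repr x.
exists (size p + n)%N => j Bj; rewrite (laurent_coefE _ xE).
case E : (j + n) => [k|//] /=; rewrite nth_default//; move: (size _) Bj => s Bj. lia.
Qed.

Lemma laurent_coef_neq0 x : x != 0 -> exists j, laurent_coef x j != 0.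
Proof.
have [[p n] /= /eqP xE] := laurent_repr x.
rewrite -(inj_eq val_inj) rmorph0 /= xE => pn0.
have p0 : p != 0 by apply: contraNneq pn0 => ->; rewrite tofrac0 mul0r.
exists ((size p).-1%:Z - n%:Z); rewrite (laurent_coefE _ xE) subrK /=.
by rewrite -lead_coefE lead_coef_eq0.
Qed.

End LaurentCoefficients.

(** * A linear functional on a module with zero first elementary ideal *)

Section FunctionalOnModule.
Local Open Scope ring_scope.
Local Notation "p %:F" := (FracField.tofrac p).

Lemma smallest_principal_gen0 (R : comNzRingType) (I : set R) :
  smallest_principal_gen I 0 -> forall x, I x -> x = 0.
Proof.
move=> [I0 _] x /I0; elim=> {x} // [x y _ -> _ ->|c x _ ->].
  by rewrite addr0.
by rewrite mulr0.
Qed.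

(** The relation exists over the field of fractions, and a common denominator of
    its entries turns it into one with polynomial entries. *)
Lemma polynomial_relation m n (P : 'M[laurent]_(m, n)) :
  (forall x, maximal_minor P x -> x = 0) ->
  exists2 u : 'rV[laurent]_m, u != 0 & u *m P = 0.
Proof.
move=> P0; pose toF : laurent -> {fraction {poly int}} := val.
have [f f_incr|v v0 vP] := @row_dependent_of_minors0 _ _ _ (map_mx toF P).
  rewrite -map_mxsub det_map_mx (P0 (\det _)) ?rmorph0//.
  by exists f.
have [d d0 [w wE]] := common_denominator (v 0).
have wF i : (w i)%:F \in laurent_pred.
  by apply/asboolP; exists (w i), 0%N; rewrite expr0 tofrac1 divr1.
pose u : 'rV[laurent]_m := \row_i Laurent (wF i).
have uE : map_mx toF u = d%:F *: v.
  by apply/rowP => i; rewrite !mxE; exact: esym (wE i).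
exists u.
  apply: contra_neq v0 => u0; have := uE; rewrite u0 map_mx0.
  move/esym/eqP; rewrite scaler_eq0 tofrac_eq0 (negPf d0) /=.
  by move/eqP.
have uP : map_mx toF (u *m P) = map_mx toF 0.
  by rewrite map_mxM map_mx0 uE -scalemxAl vP scaler0.
apply/matrixP => i j; apply: val_inj.
by have /matrixP/(_ i j) := uP; rewrite [LHS]mxE [RHS]mxE.
Qed.

(** Two coordinate vectors of an element of [M] differ by a combination of
    columns of [P], which [u] kills; so pairing the coordinates with [u] is well
    defined. It takes the value [u 0 i] on the generator of index [i]. *)
Lemma functional_of_relation (R : comNzRingType) (M : lmodType R) m n
    (P : 'M[R]_(m, n)) (u : 'rV[R]_m) :
  presents M P -> u != 0 -> u *m P = 0 ->
  exists phi : M -> R, [/\ {morph phi : a b / a + b},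
    forall x a, phi (x *: a) = x * phi a & exists a, phi a != 0].
Proof.
move=> [g [g_span g_rel]] u0 uP.
pose lin (c : 'cV_m) := \sum_i c i 0 *: g i.
pose val_u (c : 'cV_m) := (u *m c) 0 0.
pose coord v := sval (cid (g_span v)).
have coordK v : lin (coord v) = v by exact: esym (svalP (cid (g_span v))).
have linB c c' : lin (c - c') = lin c - lin c'.
  by rewrite -sumrB; apply: eq_bigr => i _; rewrite !mxE scalerBl.
have linD c c' : lin (c + c') = lin c + lin c'.
  by rewrite -big_split; apply: eq_bigr => i _; rewrite !mxE scalerDl.
have linZ x c : lin (x *: c) = x *: lin c.
  by rewrite scaler_sumr; apply: eq_bigr => i _; rewrite !mxE scalerA.
have val_lin c c' : lin c = lin c' -> val_u c = val_u c'.
  move=> /eqP; rewrite -subr_eq0 -linB => /eqP /g_rel[d cE].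
  by rewrite -(subrK c' c) cE /val_u mulmxDr mulmxA uP mul0mx add0r.
exists (val_u \o coord); split => [a b|x a|] /=.
- rewrite (val_lin _ (coord a + coord b)) ?linD ?coordK//.
  by rewrite /val_u mulmxDr mxE.
- rewrite (val_lin _ (x *: coord a)) ?linZ ?coordK//.
  by rewrite /val_u -scalemxAr mxE.
have /rV0Pn[i ui] := u0.
exists (g i); rewrite (val_lin _ (delta_mx i 0)).
  by rewrite /val_u -colE mxE.
rewrite coordK /lin (bigD1 i)//= mxE !eqxx scale1r big1 ?addr0// => j ji.
by rewrite mxE (negPf ji) scale0r.
Qed.

End FunctionalOnModule.

(** * The shift cocycle of a functional on the Alexander module *)

Lemma int_subgroup_generator (D : int -> Prop) :
  (forall x y, D x -> D y -> D (x - y)%R) -> (exists2 x, D x & x != 0%R) ->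
  exists d : int, [/\ d != 0%R, D d & forall x, D x -> (d %| x)%Z].
Proof.
move=> DB [x0 Dx0 x00].
have D0 : D 0%R by rewrite -(subrr x0); exact: DB.
have DN x : D x -> D (- x)%R by move=> Dx; rewrite -sub0r; exact: DB.
have DM x (q : int) : D x -> D (q * x)%R.
  move=> Dx; have Dn (n : nat) : D (n%:Z * x)%R.
    elim: n => [|n IHn]; first by rewrite mul0r.
    have -> : (n.+1%:Z * x = n%:Z * x - - x)%R by rewrite intS; ring.
    by apply: DB => //; exact: DN.
  by case: q => n; [exact: Dn|rewrite NegzE mulNr; apply/DN/Dn].
have ex_n : exists n : nat, (0 < n)%N && `[< D n >].
  exists `|x0|%N; rewrite absz_gt0 x00 /=; apply/asboolP.
  by case: (x0) Dx0 => n // /DN; rewrite NegzE opprK.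
case: (ex_minnP ex_n) => d /andP[d0 /asboolP Dd] d_min.
exists d%:Z%R; split => //; first by rewrite -lt0n.
move=> x Dx; apply: contraT => /dvdz_mod0P/eqP xd0.
have m0 : (0 <= (x %% d)%Z)%R by apply: modz_ge0; rewrite -lt0n.
have md : ((x %% d)%Z < d)%R by apply: ltz_pmod.
suff : (d <= `|(x %% d)%Z|)%N by lia.
apply: d_min; rewrite absz_gt0 xd0; apply/asboolP; rewrite gez0_abs//.
by rewrite /modz; apply: DB => //; exact: DM.
Qed.

Section AlexanderCoefficients.
Variables (G : groupType) (chi : {ghom G -> Algebra.to_multiplicative int}).
Variables (t : G) (phi : alexander_module chi t -> laurent).
Hypotheses (chi_t : chi t = (1%R : int))
  (phiD : forall a b, phi (a + b)%R = (phi a + phi b)%R)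
  (phiZ : forall x a, phi (x *: a)%R = (x * phi a)%R).
Local Notation K := (subgroup_of (ker chi)).
Implicit Types (k l : K) (g h : G).

Definition degree g : int := chi g.

Lemma degreeM g h : degree (g * h) = (degree g + degree h)%R.
Proof. by rewrite /degree gmulfM. Qed.

Lemma degree_expgz m : degree (expgz t m) = m.
Proof.
have d1 : degree 1 = 0%R by rewrite /degree gmulf1.
have dt n : degree (t ^+ n) = n.
  elim: n => [|n IHn]; first exact: d1.
  by rewrite expgS degreeM IHn /degree chi_t.
case: m => n; first exact: dt.
have := degreeM (t ^- n.+1) (t ^+ n.+1).
by rewrite mulVg d1 dt -[degree (expgz _ _)]/(degree (t ^- n.+1)); lia.
Qed.

Definition ker_coef k (j : int) : int :=
  laurent_coef (phi (abel_class k : alexander_module chi t)) j.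

Lemma ker_coefM k l j : ker_coef (k * l) j = (ker_coef k j + ker_coef l j)%R.
Proof. by rewrite /ker_coef abel_classM phiD laurent_coefD. Qed.

Lemma conj_ker1 k : conj_ker 1 k = k.
Proof. by apply: val_inj; rewrite /= invg1 conjg1. Qed.

Lemma conj_kerM g h k : conj_ker (g * h) k = conj_ker g (conj_ker h k).
Proof. by apply: val_inj; rewrite /= invgM conjgM. Qed.

Lemma ker_coef_conj k j : ker_coef (conj_ker t k) j = ker_coef k (j - 1)%R.
Proof.
by rewrite /ker_coef -laurent_coefXM -phiZ alexander_module_scaleX.
Qed.

(** The module structure only speaks of conjugation by [t]; negative powers are
    reached by running the one-step relation backwards. *)
Lemma ker_coef_conjz m k j :
  ker_coef (conj_ker (expgz t m) k) j = ker_coef k (j - m)%R.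
Proof.
have step n l i : ker_coef (conj_ker (expgz t (n + 1)%R) l) i =
    ker_coef (conj_ker (expgz t n) l) (i - 1)%R.
  by rewrite -ker_coef_conj -conj_kerM GRing.addrC expgzD expgz1.
have stepV n l i : ker_coef (conj_ker (expgz t n) l) i =
    ker_coef (conj_ker (expgz t (n + 1)%R) l) (i + 1)%R.
  by rewrite step addrK.
case: m => n; elim: n j => [|n IHn] j.
- by rewrite conj_ker1 subr0.
- rewrite -addn1 PoszD step IHn.
  by have -> : (j - 1 - n%:Z = j - (n%:Z + 1))%R by lia.
- rewrite stepV conj_ker1.
  by have -> : (j - Negz 0 = j + 1)%R by lia.
- rewrite stepV; have -> : (Negz n.+1 + 1 = Negz n)%R by lia.
  rewrite IHn.
  by have -> : (j + 1 - Negz n = j - Negz n.+1)%R by lia.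
Qed.

Lemma straighten_ker g : g * expgz t (- degree g)%R \in ker chi.
Proof.
rewrite kerE -/(degree _); apply/eqP.
by rewrite -[LHS]/(degree _) degreeM degree_expgz subrr.
Qed.

(** The component of [g] in [ker chi], in the decomposition of [G] as the
    semidirect product of [ker chi] and the cyclic group generated by [t]. *)
Definition straighten g : K := SubgroupElt (straighten_ker g).

Lemma straightenM g h :
  straighten (g * h) =
  straighten g * conj_ker (expgz t (degree g)) (straighten h).
Proof.
apply: val_inj; rewrite /= degreeM opprD GRing.addrC expgzD !expgzN.
by rewrite conjgE invgK !mulgA mulgVK.
Qed.

Lemma ker_coef_straightenM g h j :
  ker_coef (straighten (g * h)) j =
  (ker_coef (straighten g) j + ker_coef (straighten h) (j - degree g))%R.
Proof. by rewrite straightenM ker_coefM ker_coef_conjz. Qed.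

(** The coefficients of the values of [phi] form a subgroup of Z, generated by
    some [d]; after division by [d] the coefficient 1 occurs, and conjugation by a
    power of [t] brings it to position 0. *)
Lemma large_of_functional :
  finitely_presented G -> (exists a, phi a != 0%R) -> large G.
Proof.
move=> fpG [a /laurent_coef_neq0[j aj]].
have coef1 i : ker_coef 1 i = 0%R.
  by have := ker_coefM 1 1 i; rewrite mulg1; lia.
have coefV k i : ker_coef k^-1 i = (- ker_coef k i)%R.
  by have := ker_coefM k k^-1 i; rewrite mulgV coef1; lia.
have [|| d [d0 [k kd] d_dvd]] :=
    @int_subgroup_generator (fun x => exists k, ker_coef k 0%R = x).
- by move=> _ _ [k <-] [l <-]; exists (k * l^-1); rewrite ker_coefM coefV.
- exists (ker_coef (repr a) j); last by rewrite /ker_coef abel_class_repr.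
  exists (conj_ker (expgz t (- j)%R) (repr a)).
  by rewrite ker_coef_conjz sub0r opprK.
have d_dvd' l i : (d %| ker_coef l i)%Z.
  apply: d_dvd; exists (conj_ker (expgz t (- i)%R) l).
  by rewrite ker_coef_conjz sub0r opprK.
(* the sign turns multiplication by the variable into r |-> r + deg g *)
pose c g r := (ker_coef (straighten g) (- r)%R %/ d)%Z.
have st0 g (k' : K) : degree g = 0%R -> g = val k' -> straighten g = k'.
  by move=> g0 gk; apply: val_inj; rewrite /= g0 oppr0 mulg1.
apply: (@large_of_shift_cocycle G degree c degreeM _ _ t (val k) fpG).
- move=> g h r; rewrite /c ker_coef_straightenM divzDl//.
  by rewrite opprD.
- move=> g; have [B gB] := laurent_coef_fin (phi (abel_class (straighten g))).
  exists B => r Br; rewrite /c /ker_coef gB ?div0z//; lia.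
- exact: chi_t.
- move=> r; rewrite /c; have -> : straighten t = 1.
    apply: val_inj; rewrite /= /degree chi_t expgzN mulgV; exact: erefl.
  by rewrite coef1 div0z.
- by have := valP k; rewrite kerE => /eqP.
- have dk : degree (val k) = 0%R by have := valP k; rewrite kerE => /eqP.
  by rewrite /c (st0 _ k)// oppr0 kd divzz d0.
Qed.

End AlexanderCoefficients.

Theorem theorem2p1 (G : groupType) (hG : finitely_presented G)
    (chi : {ghom G -> Algebra.to_multiplicative int})
    (hchi : forall n : int, exists g : G, chi g = n)
    (hD : is_alexander_polynomial chi 0%R) :
  large G.
Proof.
have [t [chi_t [m [n [P [presP genP]]]]]] := hD.
have [|u u0 uP] := @polynomial_relation _ _ P.
  by move=> x Px; apply: (smallest_principal_gen0 genP); exact: ideal_gen_mem.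
have [phi [phiD phiZ phi0]] := functional_of_relation presP u0 uP.
exact: large_of_functional chi_t phiD phiZ hG phi0.
Qed.
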